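(* There exists an oracle $\mathcal{A}$ such that $\mathrm{FewP}^{\mathcal{A}}\not\subseteq \mathrm{UPH}^{\mathcal{A}}$.
   Context: Alphabet $\{0,1\}$. $\mathrm{FewP}^A$ is the class of sets accepted by a nondeterministic polynomial-time oracle Turing machine $N$ with oracle $A$ for which there is a polynomial $q$ such that $N^A(x)$ has at most $q(|x|)$ accepting paths on every input $x$. A $\Sigma_k(A)$-system $[A;N_1,\dots,N_k]$ consists of $A$ and nondeterministic polynomial-time oracle Turing machines $N_1,\dots,N_k$; its language is $L[A;N_1]=L(N_1^A)$ and $L[A;N_1,\dots,N_k]=L(N_1^{L[A;N_2,\dots,N_k]})$ for $k>1$; its computation on $x$ is that of $N_1$ on $x$ with oracle $A$ ($k=1$) or $L[A;N_2,\dots,N_k]$ ($k>1$). It is unambiguous if for every $1\le i\le k$ and every input $y$, $[A;N_i,\dots,N_k](y)$ has at most one accepting path. $\mathrm{U}\Sigma^{p,A}_0=\mathrm{P}^A$; for $k\ge1$, $\mathrm{U}\Sigma^{p,A}_k$ is the class of languages of unambiguous $\Sigma_k(A)$-systems; $\mathrm{UPH}^A=\bigcup_{k\ge0}\mathrm{U}\Sigma^{p,A}_k$. *)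

(* Defs.v *)
From mathcomp Require Import all_boot all_algebra.
From mathcomp Require Import boolp classical_sets cardinality.

Set Implicit Arguments.
Unset Strict Implicit.
Unset Printing Implicit Defensive.

Local Open Scope classical_set_scope.
Local Open Scope card_scope.

Notation word := (seq bool).
Notation lang := (set (seq bool)).

(* A tape symbol: [None] is the blank, [Some (inl b)] the input bit [b], and
   [Some (inr j)] an auxiliary symbol. *)
Definition symbol (m : nat) : finType := option (bool + 'I_m)%type.

(* [None] leaves the head in place, [Some true] moves it right, [Some false]
   moves it left. *)
Definition move : finType := option bool.

(* With [w] work tapes there are [w.+2] tapes: tape [ord0] carries the input,
   tape [ord_max] is the query tape. *)
Definition action (n m w : nat) : finType :=
  ('I_n * {ffun 'I_w.+2 -> symbol m * move})%type.

Record otm : Type := OTM {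
  nstates : nat;
  nsyms : nat;
  nwork : nat;
  start : 'I_nstates;
  accept : 'I_nstates;
  query : 'I_nstates;
  answer : bool -> 'I_nstates;
  delta : 'I_nstates -> {ffun 'I_nwork.+2 -> symbol nsyms} ->
          {set action nstates nsyms nwork} }.

(* A one-way infinite tape: the head position, and the contents of an initial
   segment of cells (all further cells are blank). *)
Record tape (m : nat) : Type := Tape { pos : nat; cells : seq (symbol m) }.

Definition blank_tape m : tape m := Tape 0 [::].

Definition read_cell m (t : tape m) : symbol m := nth None (cells t) (pos t).

(* Moving left on the leftmost cell leaves the head in place. *)
Definition act_tape m (t : tape m) (a : symbol m * move) : tape m :=
  Tape (match a.2 with
        | None => pos t
        | Some true => (pos t).+1
        | Some false => (pos t).-1
        end)
       (set_nth None (cells t) (pos t) a.1).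

(* The string on a tape: the bits up to the first cell not holding a bit. *)
Fixpoint bit_prefix m (s : seq (symbol m)) : word :=
  if s is Some (inl b) :: s' then b :: bit_prefix s' else [::].

Section Computation.
Variable N : otm.

Record config : Type := Config {
  state : 'I_(nstates N);
  tapes : 'I_(nwork N).+2 -> tape (nsyms N) }.

Definition init_config (x : word) : config :=
  Config (start N)
    (fun i => if i == ord0 then Tape 0 [seq Some (inl b) | b <- x]
              else blank_tape (nsyms N)).

Definition scanned (c : config) : {ffun 'I_(nwork N).+2 -> symbol (nsyms N)} :=
  [ffun i => read_cell (tapes c i)].

Definition apply_action (c : config)
    (a : action (nstates N) (nsyms N) (nwork N)) : config :=
  Config a.1 (fun i => act_tape (tapes c i) (a.2 i)).

Definition query_word (c : config) : word := bit_prefix (cells (tapes c ord_max)).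

(* Answering a query erases the query tape. *)
Definition apply_answer (c : config) (b : bool) : config :=
  Config (answer N b)
    (fun i => if i == ord_max then blank_tape (nsyms N) else tapes c i).

(* A step is labelled by the action chosen, or by [None] for an oracle call. *)
Definition label : Type := option (action (nstates N) (nsyms N) (nwork N)).

Inductive step (A : lang) (c : config) : label -> config -> Prop :=
| Step_action a :
    state c != accept N -> state c != query N -> a \in delta (state c) (scanned c) ->
    step A c (Some a) (apply_action c a)
| Step_query :
    state c != accept N -> state c = query N ->
    step A c None (apply_answer c `[< A (query_word c) >]).

Inductive run (A : lang) : config -> seq label -> config -> Prop :=
| Run_nil c : run A c [::] c
| Run_cons c l c' p c'' :
    step A c l c' -> run A c' p c'' -> run A c (l :: p) c''.

(* A computation path is identified with the sequence of choices along it. It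
   accepts when it reaches [accept]; it rejects when it gets stuck elsewhere. *)
Definition accepting_paths (A : lang) (x : word) : set (seq label) :=
  [set p | exists c, run A (init_config x) p c /\ state c = accept N].

Definition accepts (A : lang) : lang := [set x | accepting_paths A x !=set0].

(* The time bound is uniform in the oracle and covers every path. *)
Definition polytime : Prop :=
  exists p : {poly nat}, forall (A : lang) (x : word) (r : seq label) (c : config),
    run A (init_config x) r c -> size r <= p.[size x]%R.

Definition deterministic : Prop := forall q s, #|delta (o := N) q s| <= 1.

End Computation.

Arguments accepting_paths : clear implicits.

Record nptm : Type := NPTM { machine :> otm; polytime_nptm : polytime machine }.

Definition PTIME (A : lang) : set lang :=
  [set L | exists N : nptm, deterministic N /\ L = accepts N A].

Definition FewP (A : lang) : set lang :=
  [set L | exists (N : nptm) (q : {poly nat}),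
     (forall x, accepting_paths N A x #<= `I_(q.[size x]%R)) /\ L = accepts N A].

(* [system_lang A [:: N_1; ...; N_k]] is L[A; N_1, ..., N_k]; on the empty
   list it is the oracle [A] itself, so that the oracle of [N_k] is [A]. *)
Fixpoint system_lang (A : lang) (Ns : seq nptm) : lang :=
  if Ns is N :: Ns' then accepts N (system_lang A Ns') else A.

Fixpoint unambiguous (A : lang) (Ns : seq nptm) : Prop :=
  if Ns is N :: Ns' then
    (forall y, is_subset1 (accepting_paths N (system_lang A Ns') y)) /\
    unambiguous A Ns'
  else True.

Definition USigma (k : nat) (A : lang) : set lang :=
  if k is 0 then PTIME A
  else [set L | exists Ns : k.-tuple nptm,
                  unambiguous A Ns /\ L = system_lang A Ns].

Definition UPH (A : lang) : set lang := \bigcup_k USigma k A.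

(* Main.v *)
(* A weight argument replaces switching lemmas.  Let L(A) be the set of x such that A contains
   a word of length |x|, with A holding at most n words of each length n.  Consider oracles F + B
   with F fixed and B a set of words of length n.  If an unambiguous machine is run on the sets B
   of weight at most 2w, any two of its accepting computations on sets of weight at most w
   conflict on a queried word, since otherwise the union of their positive parts has two accepting
   paths.  Repeatedly querying the certificate of some accepting computation consistent with the
   answers so far then decides the machine with polynomially many queries on weight at most w.
   Iterating through k levels, a system that is unambiguous up to weight 2^k <= n is decided with
   fewer than 2^n queries on weight at most 1, and hence cannot tell the empty B from a
   singleton.  So at each length n used by the diagonalization some B of weight at most 2^k either
   makes the system ambiguous or makes it differ from L(A). *)

Require Import Defs.
From mathcomp Require Import all_boot all_algebra.
From mathcomp Require Import boolp classical_sets cardinality.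
From mathcomp Require Import zify.

Set Implicit Arguments.
Unset Strict Implicit.
Unset Printing Implicit Defensive.

(** * From certificates of accepted sets to certificates of all sets *)

Section Certificates.
Variable V : finType.
Implicit Types B C D R : {set V}.

(* The certificate [C B] is itself determined by the part of [B] it reads, as
   for the queries of a decision tree; an arbitrary choice of certificates
   would not do, as two of them could then differ without conflicting. *)
Definition certifies (w : nat) (f : {set V} -> bool) (C : {set V} -> {set V}) :=
  forall B B', #|B| <= w -> #|B'| <= w -> B :&: C B = B' :&: C B ->
    f B' = f B /\ C B' = C B.

Lemma setI_subset B B' C D :
  C \subset D -> B :&: D = B' :&: D -> B :&: C = B' :&: C.
Proof.
move=> /fintype.subsetP sCD /setP e; apply/setP => v; move: (e v); rewrite !finset.inE.
by case vC: (v \in C); rewrite ?andbF // (sCD _ vC) !andbT.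
Qed.

Variables (w q : nat) (f : {set V} -> bool) (K : {set V} -> {set V}).

(** In the application [K B] collects what a chosen accepting path on [B] depends on. Weight [2w] is
    assumed so that two sets of weight [w] can be merged. *)
Hypothesis K_cert : forall B B', #|B| <= w.*2 -> #|B'| <= w.*2 -> f B ->
  B :&: K B = B' :&: K B -> f B' /\ K B' = K B.
Hypothesis K_size : forall B, #|B| <= w.*2 -> f B -> #|K B| <= q.

(** One round of a decision tree: [R] is the answer pattern on the points [C] read so far. The
    choice of [D] sees only [C] and [R], never [B] itself. *)
Definition next_cert C R : {set V} :=
  if [pick D : {set V} | [&& #|D| <= w, f D & D :&: C == R]] is Some D then K D
  else finset.set0.

Definition refine B C := C :|: next_cert C (B :&: C).

Definition canonical_cert i B := iter i (refine B) finset.set0.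

Lemma canonical_certS i B :
  canonical_cert i.+1 B = refine B (canonical_cert i B).
Proof. by []. Qed.

Lemma canonical_cert_sub i j B :
  i <= j -> canonical_cert i B \subset canonical_cert j B.
Proof.
move=> /subnK <-; elim: (j - i) => //= k /fintype.subset_trans; apply.
exact: finset.subsetUl.
Qed.

Lemma canonical_cert_agree j B B' :
  B :&: canonical_cert j B = B' :&: canonical_cert j B ->
  forall i, i <= j -> canonical_cert i B' = canonical_cert i B.
Proof.
move=> e; elim=> [|i IH lt_ij]; first by move=> _.
have {}IH := IH (ltnW lt_ij).
rewrite !canonical_certS IH /refine.
by rewrite (setI_subset (canonical_cert_sub _ (ltnW lt_ij)) e).
Qed.

Lemma next_cert_size C R : #|next_cert C R| <= q.
Proof.
rewrite /next_cert; case: pickP => [D /and3P[wD fD _]|_].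
  by apply: K_size => //; lia.
by rewrite cards0.
Qed.

Lemma canonical_cert_size i B : #|canonical_cert i B| <= i * q.
Proof.
elim: i => [|i IH]; first by rewrite cards0.
rewrite mulSn addnC; apply: leq_trans (leq_card_setU _ _) _.
by apply: leq_add => //; apply: next_cert_size.
Qed.

(* The union of the two positive parts has weight at most [2 * w] and meets
   both certificates unless they conflict. *)
Lemma certs_conflict B D : #|B| <= w -> #|D| <= w -> f B -> f D ->
  (K D = K B /\ B :&: K B = D :&: K B) \/
  (exists v, [/\ v \in K B, v \in K D & (v \in B) != (v \in D)]).
Proof.
move=> wB wD fB fD.
have [[v Hv]|ncf] := pselect (exists v, [/\ v \in K B, v \in K D & (v \in B) != (v \in D)]).
  by right; exists v.
left; pose U := (B :&: K B) :|: (D :&: K D).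
have wU : #|U| <= w.*2.
  rewrite cardsU; have := subset_leq_card (finset.subsetIl B (K B)).
  by have := subset_leq_card (finset.subsetIl D (K D)); lia.
have eq v : v \in K B -> v \in K D -> (v \in B) = (v \in D).
  by move=> vB vD; apply/eqP/negPn/negP => ne; apply: ncf; exists v.
have eB : B :&: K B = U :&: K B.
  apply/setP => v; rewrite !finset.inE; case vKB: (v \in K B); rewrite ?andbF ?andbT //.
  case vKD: (v \in K D); last by rewrite andbF orbF.
  by rewrite (eq _ vKB vKD) andbT orbb.
have eD : D :&: K D = U :&: K D.
  apply/setP => v; rewrite !finset.inE; case vKD: (v \in K D); rewrite ?andbF ?andbT //.
  case vKB: (v \in K B); last by rewrite andbF.
  by rewrite (eq _ vKB vKD) andbT orbb.
have w2 B' : #|B'| <= w -> #|B'| <= w.*2 by lia.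
have [_ KB] := K_cert (w2 _ wB) wU fB eB.
have [_ KD] := K_cert (w2 _ wD) wU fD eD.
by have KDB : K D = K B := etrans (esym KD) KB; split; rewrite // eB -KDB eD.
Qed.

(** If a round picks [D] with [K D = K B], all of [K B] has been read and [B'] is accepted too.
    Otherwise [D] conflicts with [B] at a point of [K B], which is new because [D] agrees with [B]
    on the points already read. As [K B] has at most [q] points, [q + 1] rounds cannot all be of the
    second kind. *)
Lemma canonical_cert_decides B B' : #|B| <= w -> #|B'| <= w ->
  B :&: canonical_cert q.+1 B = B' :&: canonical_cert q.+1 B -> f B -> f B'.
Proof.
move=> wB wB' e fB; apply: contrapT => nfB'.
have w2 B1 : #|B1| <= w -> #|B1| <= w.*2 by lia.
suff H i : i <= q.+1 -> i <= #|canonical_cert i B :&: K B|.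
  have := H _ (leqnn _); have := subset_leq_card (finset.subsetIr (canonical_cert q.+1 B) (K B)).
  by have := K_size (w2 _ wB) fB; lia.
elim: i => // i IH lt_iq; have {IH}IH := IH (ltnW lt_iq).
set Ci := canonical_cert i B in IH.
have := canonical_cert_sub B lt_iq; rewrite canonical_certS -/Ci /refine /next_cert => sub.
(* [B] itself is a candidate, so the choice cannot fail. *)
move: sub; case: pickP => [D /and3P[wD fD /eqP eD] sub|/(_ B)]; last by rewrite wB fB eqxx.
case: (certs_conflict wB wD fB fD) => [[KDB eK]|[v [vB vD ne]]].
  case: nfB'; have sK : K B \subset canonical_cert q.+1 B.
    by apply: fintype.subset_trans sub; rewrite KDB finset.subsetUr.
  by have [] := K_cert (w2 _ wB) (w2 _ wB') fB (setI_subset sK e).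
have vCi : v \notin Ci.
  apply/negP => vCi; move/setP: eD => /(_ v); rewrite !finset.inE vCi !andbT => eD.
  by rewrite eD eqxx in ne.
apply: (leq_ltn_trans IH); apply: proper_card; apply/fintype.properP; split.
  by apply: finset.setSI; apply: finset.subsetUl.
by exists v; rewrite !finset.inE ?vD ?vB ?orbT // (negbTE vCi).
Qed.

Lemma unambiguous_certifies : exists C : {set V} -> {set V}, certifies w f C /\
  forall B, #|C B| <= q.+1 * q.
Proof.
exists (canonical_cert q.+1); split=> [B B' wB wB' e|B]; last exact: canonical_cert_size.
have eC := canonical_cert_agree e (leqnn _); split; last by [].
apply/idP/idP; last exact: canonical_cert_decides.
by apply: canonical_cert_decides; rewrite ?eC.
Qed.

End Certificates.

(** * Numerical bounds in powers of [n + 2] *)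

Lemma leq_wexp2r m n e : m <= n -> m ^ e <= n ^ e.
Proof. by case: e => // e mn; rewrite leq_exp2r. Qed.

Lemma leq_expS_add2 a e : 1 < a -> a ^ e + 2 <= a ^ e.+2.
Proof.
move=> a1; have h : 0 < a ^ e by rewrite expn_gt0; lia.
have h2 : a ^ e.+2 >= 4 * a ^ e by rewrite !expnS mulnA leq_mul2r; nia.
lia.
Qed.

Lemma poly_nat_bound (p : {poly nat}) :
  exists c, forall n, p.[n]%R <= (n + 2) ^ c.
Proof.
elim/poly_ind: p => [|p a [c IH]].
  by exists 0 => n; rewrite horner0.
exists (c.+1 + a) => n; rewrite hornerMXaddC.
have an : a < (n + 2) ^ a.
  apply: (leq_trans (ltn_expl a (ltnSn 1))).
  by apply: leq_wexp2r; rewrite addn2.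
have c0 : 0 < (n + 2) ^ c by rewrite expn_gt0; lia.
have := IH n; rewrite expnD expnS.
change ((p.[n] * n + a)%R) with (p.[n]%R * n + a).
move: (_ ^ c) (_ ^ a) (p.[n])%R c0 an => u v h u0 av hu.
have : h * n + a <= (n + 2) * u + v by nia.
by have : u * (n + 2) >= 2; nia.
Qed.

Lemma exp_dominates c m :
  exists2 n, m <= n & (n + 2) ^ c < 2 ^ n.
Proof.
pose i := (c.*2 + m).+1; have Hi : i < 2 ^ i := ltn_expl i (ltnSn 1).
have Hsq : i.+1 * i.+1 <= 2 ^ i.*2 by rewrite -addnn expnD; nia.
(* With [n + 2] a power of two, the claim reduces to comparing the exponents [2ic] and
   [2 ^ (2i) - 2]. *)
exists (2 ^ i.*2 - 2); first by rewrite /i in Hsq *; nia.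
rewrite subnK; last by nia.
rewrite -expnM ltn_exp2l //; rewrite /i in Hsq *; nia.
Qed.

(** * Runs and the words they query *)

Section Runs.
Variable N : otm.
Implicit Types (A : lang) (c : config N) (r : seq (label N)).

Lemma step_inv A c l c' : step A c l c' ->
  state c != accept N /\
  match l with
  | Some a => [/\ state c != query N, a \in delta (state c) (scanned c)
                & c' = apply_action c a]
  | None => state c = query N /\ c' = apply_answer c `[< A (query_word c) >]
  end.
Proof. by case. Qed.

Lemma run_nil_inv A c c' : run A c [::] c' -> c' = c.
Proof. by move=> h; inversion h. Qed.

Lemma run_cons_inv A c l r c' : run A c (l :: r) c' ->
  exists2 c1, step A c l c1 & run A c1 r c'.
Proof. by move=> h; inversion h; subst; exists c'0. Qed.

Fixpoint queries A c r : seq word :=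
  match r with
  | [::] => [::]
  | Some a :: r' => queries A (apply_action c a) r'
  | None :: r' =>
      query_word c :: queries A (apply_answer c `[< A (query_word c) >]) r'
  end.

Lemma size_queries A c r : size (queries A c r) <= size r.
Proof. by elim: r c => //= -[a|] r IH c; [apply: leqW|]; apply: IH. Qed.

Lemma run_local A A' r c c' :
  {in queries A c r, forall z, A z <-> A' z} -> run A c r c' ->
  run A' c r c' /\ queries A' c r = queries A c r.
Proof.
elim: r c => [|l r IH] c Heq.
  by move=> /run_nil_inv ->; split=> //; apply: Run_nil.
move=> /run_cons_inv[c1 /step_inv[nacc]].
case: l Heq => [a|] /= Heq.
  case=> nq ad -> /(IH _ Heq)[r' e]; split=> //.
  by apply: Run_cons r'; apply: Step_action.
case=> eq ->.
have eA : `[< A (query_word c) >] = `[< A' (query_word c) >].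
  by apply: asbool_equiv_eq; apply: Heq; rewrite mem_head.
move=> rr; have [|r' e] := IH _ _ rr.
  by move=> z zq; apply: Heq; rewrite inE zq orbT.
rewrite -eA; split; last by rewrite e.
by apply: Run_cons r'; rewrite eA; apply: Step_query.
Qed.

Lemma size_bit_prefix m (s : seq (symbol m)) : size (bit_prefix s) <= size s.
Proof. by elim: s => //= -[[b|j]|] s IH. Qed.

(** [t] bounds both the head position and the written part of the query tape; a step raises either
    by at most one. *)
Lemma run_size_query A t r c c' :
  pos (tapes c ord_max) <= t -> size (cells (tapes c ord_max)) <= t ->
  run A c r c' -> {in queries A c r, forall z, size z <= t + size r}.
Proof.
elim: r t c => [|l r IH] t c Hp Hs //.
move=> /run_cons_inv[c1 /step_inv[_]]; case: l => [a|] /=.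
  case=> _ _ -> rr z; rewrite -addSnnS; apply: IH rr z => /=.
    by case: ((a.2 _).2) => [[]|]; lia.
  by rewrite size_set_nth geq_max ltnS Hp leqW.
case=> _ -> rr z; rewrite inE => /orP[/eqP->|].
  by apply: leq_trans (size_bit_prefix _) (leq_trans Hs (leq_addr _ _)).
rewrite -addSnnS; apply: IH rr z => /=; rewrite eqxx //=.
Qed.

Lemma init_run_size_query A x r c : run A (init_config N x) r c ->
  {in queries A (init_config N x) r, forall z, size z <= size r}.
Proof. exact: (@run_size_query A 0). Qed.

Lemma accept_run_end A r c c' : state c = accept N -> run A c r c' -> r = [::].
Proof.
move=> e; case: r => // l r /run_cons_inv[c1 /step_inv[]].
by rewrite e eqxx.
Qed.

Lemma deterministic_accepting_paths A x :
  deterministic N -> is_subset1 (accepting_paths N A x).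
Proof.
move=> det r1 r2 [c1 [h1 a1]] [c2 [h2 a2]].
elim: r1 r2 (init_config N x) h1 h2 => [|l1 r1 IH] r2 c h1 h2.
  by rewrite (run_nil_inv h1) in a1; rewrite (accept_run_end a1 h2).
case: r2 h2 => [|l2 r2] h2.
  by rewrite (run_nil_inv h2) in a2; rewrite (accept_run_end a2 h1).
have [d1 /step_inv[_ s1] {}h1] := run_cons_inv h1.
have [d2 /step_inv[_ s2] {}h2] := run_cons_inv h2.
case: l1 l2 s1 s2 => [b1|] [b2|].
- move=> [_ i1 e1] [_ i2 e2].
  have eb : b1 = b2 by have /fintype.card_le1_eqP := det (state c) (scanned c); apply.
  by subst; rewrite (IH _ _ h1 h2).
- by move=> [/eqP n _ _] [/n].
- by move=> [e _] [/eqP/(_ e)].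
- by move=> [_ e1] [_ e2]; subst; rewrite (IH _ _ h1 h2).
Qed.

End Runs.

Lemma nptm_time_bound (N : nptm) : exists e, forall A x r c,
  run A (init_config N x) r c -> size r <= (size x + 2) ^ e.
Proof.
have [p Hp] := polytime_nptm N; have [e He] := poly_nat_bound p.
by exists e => A x r c /Hp /leq_trans; apply.
Qed.

(** * Finite use of the oracle *)

Definition agree_below (b : nat) (A A' : lang) :=
  forall z, size z < b -> A z <-> A' z.

Lemma agree_below_trans b A1 A2 A3 :
  agree_below b A1 A2 -> agree_below b A2 A3 -> agree_below b A1 A3.
Proof. by move=> h1 h2 z zb; apply: iff_trans (h1 z zb) (h2 z zb). Qed.

Lemma agree_below_sym b A A' : agree_below b A A' -> agree_below b A' A.
Proof. by move=> h z zb; apply: iff_sym; apply: h. Qed.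

Lemma agree_below_leq b b' A A' :
  b <= b' -> agree_below b' A A' -> agree_below b A A'.
Proof. by move=> bb h z zb; apply: h; apply: leq_trans bb. Qed.

Lemma accepting_paths_local (N : nptm) : exists e, forall A A' x,
  agree_below ((size x + 2) ^ e).+1 A A' ->
  accepting_paths N A x = accepting_paths N A' x.
Proof.
have [e He] := nptm_time_bound N; exists e.
suff H A A' x : agree_below ((size x + 2) ^ e).+1 A A' ->
  (accepting_paths N A x `<=` accepting_paths N A' x)%classic.
  by move=> A A' x hA; rewrite eqEsubset; split; apply: H => //; apply: agree_below_sym.
move=> hA r [c [rr ac]]; exists c; split=> //.
apply: (proj1 (run_local _ rr)) => z zq; apply: hA; rewrite ltnS.
exact: leq_trans (init_run_size_query rr zq) (He _ _ _ _ rr).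
Qed.


Lemma system_lang_local Ns l : exists b, forall A A', agree_below b A A' ->
  agree_below l (system_lang A Ns) (system_lang A' Ns).
Proof.
elim: Ns l => [|N Ns IH] l; first by exists l.
have [e He] := accepting_paths_local N.
have [b Hb] := IH ((l + 2) ^ e).+1; exists b => A A' /Hb h y yl /=.
rewrite /accepts /mkset (He _ (system_lang A' Ns)) //.
apply: agree_below_leq h; rewrite ltnS leq_wexp2r // leq_add2r ltnW//.
Qed.

(** Ambiguity shows at one level on a single input, whose paths depend on a finite part of the
    oracle. *)
Lemma ambiguous_local A Ns : ~ unambiguous A Ns ->
  exists b, forall A', agree_below b A A' -> ~ unambiguous A' Ns.
Proof.
elim: Ns => [|N Ns IH] //= /not_andP[/existsNP[y amb]|/IH[b Hb]]; last first.
  by exists b => A' /Hb h [].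
have [e He] := accepting_paths_local N.
have [b Hb] := system_lang_local Ns ((size y + 2) ^ e).+1.
by exists b => A' /Hb /He h [/(_ y)]; rewrite -h.
Qed.

(** * Certificates for unambiguous systems *)

Definition extend_oracle (F : lang) n (B : {set n.-tuple bool}) : lang :=
  [set x | F x \/ exists2 v, v \in B & tval v = x]%classic.

Lemma card_bigcup_seq (V : finType) (I : eqType) (s : seq I) (C : I -> {set V}) d :
  {in s, forall i, #|C i| <= d} -> #|\bigcup_(i <- s) C i| <= size s * d.
Proof.
elim: s => [|i s IH] H; first by rewrite big_nil cards0.
rewrite big_cons /= mulSn; apply: leq_trans (leq_card_setU _ _) _.
apply: leq_add; first by apply: H; rewrite mem_head.
by apply: IH => j js; apply: H; rewrite inE js orbT.
Qed.

(** Agreement on the certificates of all queried words fixes every oracle answer along the run,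
    hence the run, its queries and their certificates. *)
Lemma run_certificate F n w Ns (C : word -> {set n.-tuple bool} -> {set n.-tuple bool})
    (N : otm) c c' r (B B' : {set n.-tuple bool}) :
  let O B := system_lang (extend_oracle F B) Ns in
  let K := \bigcup_(z <- queries (O B) c r) C z B in
  (forall z, certifies w (fun B => `[< O B z >]) (C z)) ->
  #|B| <= w -> #|B'| <= w -> B :&: K = B' :&: K ->
  run (N := N) (O B) c r c' ->
  [/\ run (O B') c r c', queries (O B') c r = queries (O B) c r
    & \bigcup_(z <- queries (O B') c r) C z B' = K].
Proof.
move=> O K cert wB wB' e rr.
have H z : z \in queries (O B) c r -> (O B z <-> O B' z) /\ C z B' = C z B.
  move=> zq; have sub : C z B \subset K by rewrite /K (big_rem z zq) /= finset.subsetUl.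
  have [e1 e2] := cert z B B' wB wB' (setI_subset sub e).
  by split; last exact: e2; exact: asbool_eq_equiv (esym e1).
have [r' eq] := run_local (fun z zq => proj1 (H z zq)) rr.
split=> //; rewrite eq; rewrite [in LHS]big_seq [RHS]big_seq.
by apply: eq_bigr => z /H[].
Qed.

(** Here [a] is [size y + 2]. There are at most [a ^ e] queries, of length at most [a ^ e], each
    with a certificate of size at most [(a ^ e + 2) ^ c]. *)
Lemma cert_size_bound a e c :
  1 < a -> (a ^ e * (a ^ e + 2) ^ c).+1 * (a ^ e * (a ^ e + 2) ^ c) <=
           a ^ ((e + e.+2 * c).+2 + (e + e.+2 * c)).
Proof.
move=> a1; set q := a ^ e * _.
have hq : q <= a ^ (e + e.+2 * c).
  rewrite /q expnD leq_mul2l expnM leq_wexp2r ?orbT //.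
  exact: leq_expS_add2.
rewrite expnD; apply: leq_mul => //.
by have := leq_expS_add2 (e + e.+2 * c) a1; lia.
Qed.

(** Induction on the levels, halving the weight at each one. The exponent depends on the machines
    only, so [n] can be chosen after it. *)
Lemma system_certificates Ns : exists c, forall F n w,
  (forall B : {set n.-tuple bool}, #|B| <= 2 ^ size Ns * w ->
     unambiguous (extend_oracle F B) Ns) ->
  forall y, exists C : {set n.-tuple bool} -> {set n.-tuple bool},
    certifies w (fun B => `[< system_lang (extend_oracle F B) Ns y >]) C /\
      forall B : {set n.-tuple bool}, #|B| <= w -> #|C B| <= (size y + 2) ^ c.
Proof.
elim: Ns => [|N Ns [c IH]].
  exists 0 => F n w _ y.
  (* With no machine left the oracle itself is asked, and only the word [y] matters. *)
  exists (fun=> [set v : n.-tuple bool | tval v == y]); split; last first.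
    move=> B _; rewrite expn0; apply/fintype.card_le1_eqP => u v.
    by rewrite !finset.inE => /eqP uy /eqP vy; apply: val_inj; rewrite /= uy vy.
  move=> B B' _ _ /setP e; split=> //; apply: asbool_equiv_eq => /=.
  have H v : tval v = y -> (v \in B) = (v \in B').
    by move=> vy; move: (e v); rewrite !finset.inE vy eqxx !andbT.
  split=> -[Fy|[v vB vy]]; [by left| |by left|]; right; exists v => //.
  - by rewrite H.
  - by rewrite -H.
have [e He] := nptm_time_bound N.
exists ((e + e.+2 * c).+2 + (e + e.+2 * c)) => F n w Hun y.
(* The inner system is certified up to weight [2w], as the conflict argument for [N] needs. *)
have /(IH F n w.*2)/choice[Cz HC] : forall B : {set n.-tuple bool}, #|B| <= 2 ^ size Ns * w.*2 ->
     unambiguous (extend_oracle F B) Ns.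
  by move=> B hB; have [] // := Hun B; rewrite /= expnS -mulnA mulnCA mul2n.
pose O (B : {set n.-tuple bool}) := system_lang (extend_oracle F B) Ns.
pose path B := xget [::] (accepting_paths N (O B) y).
pose K B := \bigcup_(z <- queries (O B) (init_config N y) (path B)) Cz z B.
pose f (B : {set n.-tuple bool}) := `[< accepts N (O B) y >].
have pathP B : f B -> accepting_paths N (O B) y (path B).
  by move=> /asboolP[r hr]; apply: xgetPex; exists r.
have [||C [hC1 hC2]] := @unambiguous_certifies _ w 
    ((size y + 2) ^ e * ((size y + 2) ^ e + 2) ^ c) f K.
- move=> B B' wB wB' fB eK; have [c' [rr acc]] := pathP _ fB.
  have [r' eq eqK] := run_certificate (fun z => proj1 (HC z)) wB wB' eK rr.
  have pB' : accepting_paths N (O B') y (path B) by exists c'.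
  have fB' : f B' by apply/asboolP; exists (path B).
  (* The path chosen for [B] also accepts on [B'], so unambiguity makes it the path chosen for
     [B']. *)
  have epath : path B' = path B.
    have [amb _] : unambiguous (extend_oracle F B') (N :: Ns).
      apply: Hun; apply: leq_trans wB' _.
      by rewrite /= expnS -mulnA mulnCA mul2n leq_pmull // expn_gt0.
    exact: (amb y _ _ (pathP _ fB') pB').
  by split=> //; rewrite /K epath.
- move=> B wB fB; have [c' [rr acc]] := pathP _ fB.
  apply: leq_trans (_ : size (queries (O B) (init_config N y) (path B)) *
    ((size y + 2) ^ e + 2) ^ c <= _).
    apply: card_bigcup_seq => z zq; apply: leq_trans (proj2 (HC z) _ wB) _.
    apply: leq_wexp2r; rewrite leq_add2r.
    exact: leq_trans (init_run_size_query rr zq) (He _ _ _ _ rr).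
  by rewrite leq_mul2r (leq_trans (size_queries _ _ _) (He _ _ _ _ rr)) orbT.
exists C; split=> // B _; apply: leq_trans (hC2 B) _.
by apply: cert_size_bound; rewrite addn2.
Qed.

(** * The test language and its FewP machine *)

Definition length_shadow (A : lang) : lang :=
  [set x | exists2 y, A y & size y = size x]%classic.

Definition few_words (A : lang) :=
  forall n, ([set x | A x /\ size x = n]%classic #<= `I_n)%card.

Section GuessMachine.

Definition q_guess : 'I_4 := @Ordinal 4 0 isT.
Definition q_ask : 'I_4 := @Ordinal 4 1 isT.
Definition q_yes : 'I_4 := @Ordinal 4 2 isT.
Definition q_no : 'I_4 := @Ordinal 4 3 isT.

(* The input is erased as it is read, so that the labels on a path depend on the
   guessed word only. *)
Definition guess_bit (b : bool) : action 4 0 0 :=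
  (q_guess, [ffun i => (if i == ord_max then Some (inl b) else None, Some true)]).

Definition ask_oracle : action 4 0 0 := (q_ask, [ffun=> (None, None)]).

Definition guess_machine : otm :=
  @OTM 4 0 0 q_guess q_yes q_ask (fun b => if b then q_yes else q_no)
    (fun q s =>
       if q == q_guess then
         if s ord0 is Some (inl _) then [set guess_bit b | b : bool]
         else [set ask_oracle]
       else finset.set0).

Notation gconfig := (config guess_machine).

(** Stated relative to the head, so nothing is claimed about the erased cells behind it. *)
Definition input_left (c : gconfig) (x : word) := forall j,
  nth None (cells (tapes c ord0)) (pos (tapes c ord0) + j) =
  nth None [seq Some (inl b) | b <- x] j.

Definition guessing (c : gconfig) (x u : word) :=
  [/\ state c = q_guess, input_left c x
    & tapes c ord_max = Tape (size u) [seq Some (inl b) | b <- u]].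

Lemma set_nth_size_map (T S : Type) (f : S -> T) (x0 : T) s y :
  set_nth x0 (map f s) (size s) y = rcons (map f s) y.
Proof. by elim: s => //= z s ->. Qed.

Lemma bit_prefix_map m (u : word) s :
  bit_prefix ([seq Some (inl b) | b <- u] ++ None :: s : seq (symbol m)) = u.
Proof. by elim: u => //= b u ->. Qed.

Lemma guessing_init x : guessing (init_config guess_machine x) x [::].
Proof. by split. Qed.

Lemma guessing_bit c a x u b :
  guessing c (a :: x) u -> guessing (apply_action c (guess_bit b)) x (rcons u b).
Proof.
move=> [_ inp tq]; split=> //=.
- move=> j; rewrite /= ffunE /= nth_set_nth /= addSnnS ifN; last by lia.
  by rewrite inp.
- rewrite ffunE eqxx tq /act_tape /= size_rcons map_rcons; congr (Tape _ _).
  exact: set_nth_size_map.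
Qed.

Lemma guessing_scanned c x u : guessing c x u ->
  scanned c ord0 = nth None [seq Some (inl b) | b <- x] 0.
Proof. by move=> [_ inp _]; rewrite ffunE /read_cell -inp addn0. Qed.

Lemma guessing_done c u : guessing c [::] u ->
  query_word (apply_action c ask_oracle) = u.
Proof.
move=> [_ _ tq]; rewrite /query_word /= ffunE tq /=.
by rewrite set_nth_size_map -cats1 bit_prefix_map.
Qed.

Definition guess_path (v : word) : seq (label guess_machine) :=
  [seq Some (guess_bit b) | b <- v] ++ [:: Some ask_oracle; None].

Lemma stuck_run A (c : gconfig) r c' : state c = q_yes \/ state c = q_no ->
  run A c r c' -> r = [::].
Proof.
case: r => // l r sc /run_cons_inv[c1 /step_inv[_]]; case: l => [a|].
  by move=> [_]; case: sc => -> /=; rewrite finset.inE.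
by case: sc => -> [].
Qed.

(** One induction gives both the running time and the fact that an accepting path is determined by
    its guessed word. *)
Lemma guessing_run A x c u r c' : guessing c x u -> run A c r c' ->
  size r <= (size x).+2 /\
  (state c' = q_yes -> exists v, [/\ r = guess_path v, size v = size x & A (u ++ v)]).
Proof.
elim: x c u r => [|a x IH] c u [|l r] g.
- by move=> /run_nil_inv ->; have [-> _ _] := g.
- move=> /run_cons_inv[c1 /step_inv[_]]; have gs := guessing_scanned g.
  have gd := guessing_done g; have [eq _ _] := g.
  case: l => [act|]; last by rewrite eq => -[].
  rewrite eq /= gs finset.inE => -[_ /eqP -> ->].
  case: r => [|l r]; first by move=> /run_nil_inv ->.
  move=> /run_cons_inv[c2 /step_inv[_]].
  case: l => [act'|]; first by move=> [].
  rewrite gd => -[_ ->] rr.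
  have re : r = [::] by apply: stuck_run rr; case: asboolP => _; [left|right].
  rewrite re in rr *; split=> // ; rewrite (run_nil_inv rr) /=.
  by case: asboolP => // Au _; exists [::]; rewrite cats0.
- by move=> /run_nil_inv ->; have [-> _ _] := g.
move=> /run_cons_inv[c1 /step_inv[_]]; have gs := guessing_scanned g.
have [eq _ _] := g; case: l => [act|]; last by rewrite eq => -[].
rewrite eq /= gs => -[_ /imsetP[b _ ->] ->].
move=> /(IH _ _ _ (guessing_bit b g))[sz acc]; split=> // /acc[v [-> sv Av]].
by exists (b :: v); rewrite /= sv; split=> //; rewrite -cat_rcons.
Qed.

Lemma guessing_accept A x c u v : guessing c x u -> size v = size x -> A (u ++ v) ->
  exists c', run A c (guess_path v) c' /\ state c' = q_yes.
Proof.
elim: x c u v => [|a x IH] c u [|b v] //= g.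
  rewrite cats0 => _ Au; exists (apply_answer (apply_action c ask_oracle) true).
  split=> //; have gs := guessing_scanned g; have [eq _ _] := g.
  apply: Run_cons (apply_action c ask_oracle) _ _ _ _.
    by apply: Step_action; rewrite eq //= gs /= finset.inE.
  have -> : true = `[< A (query_word (apply_action c ask_oracle)) >].
    by rewrite (guessing_done g); apply/esym/asboolP.
  by apply: Run_cons (Run_nil _ _); apply: Step_query.
move=> [sv] Av; have gs := guessing_scanned g; have [eq _ _] := g.
have [|c' [rr acc]] := IH _ _ v (guessing_bit b g) sv; first by rewrite cat_rcons.
exists c'; split=> //; apply: Run_cons rr.
by apply: Step_action; rewrite eq //= gs; apply: imset_f.
Qed.

Lemma guess_machine_polytime : polytime guess_machine.
Proof.
exists ('X + 2%:P)%R => A x r c /(guessing_run (guessing_init x))[+ _].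
by rewrite hornerD hornerX hornerC -addn2.
Qed.

(** Every accepting path on [x] is [guess_path v] for some [v] in [A] of length [size x], so there
    are at most [size x] of them. *)
Lemma length_shadow_FewP A : few_words A -> FewP A (length_shadow A).
Proof.
move=> few; exists (NPTM guess_machine_polytime), 'X%R; split.
  move=> x; rewrite hornerX; apply: card_le_trans (few (size x)).
  apply: card_le_trans (card_image_le guess_path _); apply: subset_card_le.
  move=> r [c [rr acc]].
  have [_ /(_ acc)[v [-> sv Av]]] := guessing_run (guessing_init x) rr.
  by exists v.
apply/seteqP; split=> x.
  by move=> [v Av sv]; exists (guess_path v); apply: guessing_accept (guessing_init x) _ _.
move=> [r [c [rr acc]]].
by have [_ /(_ acc)[v [_ sv Av]]] := guessing_run (guessing_init x) rr; exists v.
Qed.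

End GuessMachine.

(** * Countably many systems *)

(** Replacing functions by finite functions makes the machines of each format a finite type, so the
    union over all formats is countable. *)
Definition otm_data (d : nat * nat * nat) : finType :=
  let: (n, m, w) := d in
  ('I_n * 'I_n * 'I_n * {ffun bool -> 'I_n} *
   {ffun 'I_n -> {ffun {ffun 'I_w.+2 -> symbol m} -> {set action n m w}}})%type.

Definition otm_encode (N : otm) : {d : nat * nat * nat & otm_data d} :=
  existT otm_data (nstates N, nsyms N, nwork N)
    (start N, accept N, query N, finfun (@answer N),
     [ffun q => finfun (@delta N q)]).

Definition otm_decode (e : {d : nat * nat * nat & otm_data d}) : otm :=
  let: existT (n, m, w) (s, a, q, ans, del) := e in
  @OTM n m w s a q ans (fun q => del q).

Lemma otm_encodeK : cancel otm_encode otm_decode.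
Proof.
case=> n m w s a q ans del; rewrite /otm_encode /otm_decode /=; congr OTM.
  by apply/funext => b; rewrite ffunE.
by apply/funext => p; apply/funext => t; rewrite !ffunE.
Qed.

Definition system_code (Ns : seq nptm) : nat :=
  pickle [seq otm_encode (machine N) | N <- Ns].

Lemma system_code_inj : injective system_code.
Proof.
move=> Ns Ms /(pcan_inj pickleK); apply: inj_map => -[N pN] [M pM] /= h.
have e := can_inj otm_encodeK h; subst; congr NPTM; exact: Prop_irrelevance.
Qed.

(** * Diagonalization *)

Definition defeats (A : lang) (Ns : seq nptm) :=
  unambiguous A Ns -> length_shadow A <> system_lang A Ns.

Lemma length_shadow_local A A' x :
  agree_below (size x).+1 A A' -> length_shadow A x <-> length_shadow A' x.
Proof. by move=> h; split=> -[y Ay sy]; exists y => //; apply/h; rewrite // sy. Qed.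

(** Either form of defeat, ambiguity or a wrong answer, shows on one input and so survives later
    changes at large lengths. *)
Lemma defeats_local A Ns : defeats A Ns ->
  exists b, forall A', agree_below b A A' -> defeats A' Ns.
Proof.
move=> def; have [una|/ambiguous_local[b Hb]] := pselect (unambiguous A Ns); last first.
  by exists b => A' /Hb nu /nu.
have /existsNP[x nx] : ~ forall x, length_shadow A x <-> system_lang A Ns x.
  by move=> h; apply: def => //; apply/seteqP; split=> x /h.
have [b Hb] := system_lang_local Ns (size x).+1.
exists (maxn b (size x).+1) => A' hA _ eL; apply: nx.
have hb := agree_below_leq (leq_maxl _ _) hA.
have hx := agree_below_leq (leq_maxr _ _) hA.
apply: iff_trans (length_shadow_local hx) _; rewrite eL.
by apply: iff_sym; apply: Hb.
Qed.

Lemma exists_defeating_extension F m Ns : (forall x, F x -> size x < m) ->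
  exists n (B : {set n.-tuple bool}),
    [/\ m <= n, #|B| <= n & defeats (extend_oracle F B) Ns].
Proof.
move=> Fm; have [c Hc] := system_certificates Ns.
have [n] := exp_dominates c (maxn m (2 ^ size Ns)).
rewrite geq_max => /andP[mn kn] cn; exists n.
have [[B [Bk nu]]|una] := pselect (exists B : {set n.-tuple bool},
    #|B| <= 2 ^ size Ns /\ ~ unambiguous (extend_oracle F B) Ns).
  by exists B; split; [|exact: leq_trans kn|move=> /nu].
have {}una (B : {set n.-tuple bool}) : #|B| <= 2 ^ size Ns * 1 ->
    unambiguous (extend_oracle F B) Ns.
  by rewrite muln1 => Bk; apply: contrapT => nu; apply: una; exists B.
pose y := nseq n false; have sy : size y = n by rewrite size_nseq.
have [C [cert sC]] := Hc F n 1 una y.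
(* The certificate of the empty set has fewer than [2 ^ n] words. The system answers alike on the
   empty set and on [[set v]], while the test language differs at [y]. *)
have [v vC] : exists v, v \notin C finset.set0.
  have : C finset.set0 \proper [set: n.-tuple bool].
    rewrite properEcard finset.subsetT cardsT card_tuple card_bool.
    by apply: leq_ltn_trans cn; rewrite -[in leqRHS]sy; apply: sC; rewrite cards0.
  by move=> /properP[_ [v _ vC]]; exists v.
have ev0 : finset.set0 :&: C finset.set0 = [set v] :&: C finset.set0.
  by rewrite finset.set0I; apply/esym/eqP; rewrite finset.setI_eq0 disjoints1.
have [|| ev _] := cert finset.set0 [set v] _ _ ev0; rewrite ?cards0 ?cards1 //.
have sh0 : ~ length_shadow (extend_oracle F (finset.set0 : {set n.-tuple bool})) y.
  move=> [z [/Fm|[u]] ]; last by rewrite finset.inE.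
  by rewrite -sy in mn * => lt_z ez; move: lt_z; rewrite ez ltnNge mn.
have sh1 : length_shadow (extend_oracle F [set v]) y.
  by exists (tval v); rewrite ?size_tuple //; right; exists v => //; rewrite finset.inE.
have [S0|nS0] := pselect (system_lang (extend_oracle F (finset.set0 : {set n.-tuple bool})) Ns y).
  by exists finset.set0; rewrite cards0; split=> // _ eL; apply: sh0; rewrite eL.
exists [set v]; rewrite cards1; split=> //.
  by apply: leq_trans kn; rewrite expn_gt0.
by move=> _ eL; apply: nS0; apply/(asbool_eq_equiv ev); rewrite -eL.
Qed.

Definition finite_stage (F : lang) m := (forall x, F x -> size x < m) /\ few_words F.

(** As [m <= n], [F] has no word of length [n], so only [B] counts there. *)
Lemma extend_oracle_stage F m n (B : {set n.-tuple bool}) :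
  m <= n -> #|B| <= n -> finite_stage F m -> finite_stage (extend_oracle F B) n.+1.
Proof.
move=> mn Bn [Fm few]; split.
  by move=> x [/Fm|[v _ <-]]; [lia|rewrite size_tuple].
move=> l; have [->|ne] := eqVneq l n; last first.
  apply: card_le_trans (few l); apply: subset_card_le => x [[Fx|[v _ vx]] sx]; first by [].
  by move: ne; rewrite -sx -vx size_tuple eqxx.
apply: card_le_trans (card_image_le (nth [::] [seq tval v | v <- enum B]) _).
apply: subset_card_le => x [[/Fm|[v vB <-] _]]; first by lia.
exists (index v (enum B)); last by rewrite (nth_map v) ?nth_index ?index_mem ?mem_enum.
by apply: leq_trans Bn; rewrite /= cardE index_mem mem_enum.
Qed.

Lemma next_stage i F m : finite_stage F m -> exists F' m',
  [/\ finite_stage F' m', m < m', agree_below m F F' &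
   forall Ns A, system_code Ns = i -> agree_below m' F' A -> defeats A Ns].
Proof.
move=> st; have [[Ns code]|nocode] := pselect (exists Ns, system_code Ns = i); last first.
  (* If [i] codes no system, only the bound grows. *)
  exists F, m.+1; split=> // [|Ns A code]; last by case: nocode; exists Ns.
  by split; [move=> x /(proj1 st)/ltnW|exact: (proj2 st)].
have [n [B [mn Bn def]]] := exists_defeating_extension Ns (proj1 st).
have [b Hb] := defeats_local def.
exists (extend_oracle F B), (maxn b n.+1); split.
- have [h few] := extend_oracle_stage mn Bn st; split=> // x /h.
  by rewrite leq_max => ->; rewrite orbT.
- by rewrite leq_max ltnS mn orbT.
- move=> z zm; split; first by left.
  by case=> // -[v _ vz]; move: zm; rewrite -vz size_tuple ltnNge mn.
- move=> Ms A; rewrite -code => /system_code_inj -> h.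
  by apply: Hb; apply: agree_below_leq h; apply: leq_maxl.
Qed.

Lemma exists_diagonal_oracle : exists2 A, few_words A & forall Ns, defeats A Ns.
Proof.
have /choice[nxt Hn] : forall p : nat * (lang * nat), exists st' : lang * nat,
    finite_stage p.2.1 p.2.2 ->
    [/\ finite_stage st'.1 st'.2, p.2.2 < st'.2, agree_below p.2.2 p.2.1 st'.1 &
   forall Ns A, system_code Ns = p.1 -> agree_below st'.2 st'.1 A -> defeats A Ns].
  move=> [i [F m]] /=; have [st|nst] := pselect (finite_stage F m).
    by have [F' [m' h]] := next_stage i st; exists (F', m').
  by exists (F, m).
pose st := fix st i := if i is j.+1 then nxt (j, st j) else (set0 : lang, 0).
have fin i : finite_stage (st i).1 (st i).2.
  elim: i => [|i IH] /=; last by have [] := Hn (i, st i) IH.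
  split=> [x []|l]; apply: (card_le_trans _ (card_ge0 word _)).
  by apply: subset_card_le => x [].
have {}Hn i := Hn (i, st i) (fin i).
have le_st i : i <= (st i).2.
  by elim: i => // i IH; have [_ h _ _] := Hn i; apply: leq_ltn_trans IH h.
have mono i j : i <= j -> (st i).2 <= (st j).2.
  move=> /subnK <-; elim: (j - i) => // k IH; have [_ h _ _] := Hn (k + i).
  exact: leq_trans IH (ltnW h).
have agr i j : i <= j -> agree_below (st i).2 (st i).1 (st j).1.
  move=> ij; rewrite -(subnK ij); elim: (j - i) => // k IH.
  have [_ _ h _] := Hn (k + i); apply: agree_below_trans IH _.
  by apply: agree_below_leq h; apply: mono; apply: leq_addl.
(* By stage [size z + 1] the bound exceeds [size z], so membership of [z] is settled. *)
pose A : lang := fun z => (st (size z).+1).1 z.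
have agrA i : agree_below (st i).2 (st i).1 A.
  move=> z zi; have [le|/ltnW le] := leqP i (size z).+1; first exact: agr le _ zi.
  apply: iff_sym; apply: agr le _ _; exact: le_st.
exists A => [l|Ns].
  apply: card_le_trans ((proj2 (fin l.+1)) l); apply: subset_card_le.
  by move=> x [Ax <-].
by have [_ _ _ h] := Hn (system_code Ns); apply: h (agrA _.+1).
Qed.

Theorem theorem4p2 : exists A : lang, ~ (FewP A `<=` UPH A)%classic.
Proof.
have [A few def] := exists_diagonal_oracle; exists A => sub.
have [[|k] _] := sub _ (length_shadow_FewP few).
  (* Level 0 falls under the same argument: a deterministic machine is a one-level unambiguous
     system. *)
  move=> [N [det eL]]; apply: (def [:: N]) => //; split=> // y.
  exact: deterministic_accepting_paths.
by move=> [Ns [una eL]]; apply: def una eL.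
Qed.
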